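(* Let $A\in\mathbb{R}^{n\times n}$, $B\in\mathbb{R}^{n\times m}$, and let $F\in\mathbb{R}^{r\times n}$ have full row rank $r$. Consider the system $\dot{x}(t)=Ax(t)+Bu(t)$ with target output $z(t)=Fx(t)$, and let $\mathcal{C}=\begin{pmatrix}B & AB & \cdots & A^{n-1}B\end{pmatrix}$. The following conditions are equivalent: 1) The triple $(A,B,F)$ is target output controllable. 2) $\operatorname{rank}(F)=\operatorname{rank}(F\mathcal{C})$. 3) $\operatorname{rank}(F)=\operatorname{rank}\begin{pmatrix}FB & F(A-sI)B & \cdots & F(A-sI)^{n-1}B\end{pmatrix}$ for all $s\in\mathbb{C}$.
   Context: The triple $(A,B,F)$ is called target output controllable if for any initial state $x(t_0)\in\mathbb{R}^n$ (with initial target value $z(t_0)=Fx(t_0)$) and any desired target value $z^*\in\mathbb{R}^r$, there exist a finite time $t>t_0$ and an input $u:[t_0,t]\to\mathbb{R}^m$ (say piecewise continuous) such that the solution $x$ of $\dot{x}=Ax+Bu$ starting from $x(t_0)$ satisfies $Fx(t)=z^*$. *)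

(* Defs.v *)
From mathcomp Require Import all_boot all_order all_algebra.
From mathcomp Require Import all_classical all_reals all_analysis.
From mathcomp Require Import complex.

Set Implicit Arguments.
Unset Strict Implicit.
Unset Printing Implicit Defensive.

Import Order.TTheory GRing.Theory Num.Theory.
Import numFieldNormedType.Exports.

Local Open Scope classical_set_scope.
Local Open Scope ring_scope.

(* Only the values of f on [a, b] matter. Finitely many jumps are allowed
   (those listed in s); the values of f at the jumps, and at a and b, are
   unconstrained. *)
Definition piecewise_continuous (R : realType) (m : nat) (a b : R)
    (f : R -> 'cV[R]_m) : Prop :=
  exists s : seq R,
    [/\ forall t, a < t < b -> t \notin s -> {for t, continuous f},
        forall t, a <= t < b -> cvg (f @ t^'+)
      & forall t, a < t <= b -> cvg (f @ t^'-)].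

(* For a piecewise continuous input u, the differential equation is required
   at the points of continuity of u, i.e. at all but finitely many times, and
   x is continuous across the jumps of u; this is the usual notion of solution,
   and such an x is unique on [a, b]. *)
Definition state_solution (R : realType) (n m : nat)
    (A : 'M[R]_n) (B : 'M[R]_(n, m)) (a b : R)
    (u : R -> 'cV[R]_m) (x0 : 'cV[R]_n) (x : R -> 'cV[R]_n) : Prop :=
  [/\ x a = x0,
      {within `[a, b], continuous x}
    & forall t, a < t < b -> {for t, continuous u} ->
        is_derive t 1 x (A *m x t + B *m u t)].

Definition target_output_controllable (R : realType) (n m r : nat) (t0 : R)
    (A : 'M[R]_n) (B : 'M[R]_(n, m)) (F : 'M[R]_(r, n)) : Prop :=
  forall (x0 : 'cV[R]_n) (z : 'cV[R]_r),
  exists (t1 : R) (u : R -> 'cV[R]_m) (x : R -> 'cV[R]_n),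
    [/\ t0 < t1, piecewise_continuous t0 t1 u,
        state_solution A B t0 t1 u x0 x & F *m x t1 = z].

Definition controllability_mx (R : realType) (n m : nat)
    (A : 'M[R]_n) (B : 'M[R]_(n, m)) : 'M[R]_(n, \sum_(k < n) m) :=
  \mxrow_(k < n) (A ^+ k *m B).

Definition complex_mx (R : realType) (p q : nat) (M : 'M[R]_(p, q)) :
  'M[R[i]]_(p, q) := map_mx (real_complex R) M.

Definition shifted_target_mx (R : realType) (n m r : nat)
    (A : 'M[R]_n) (B : 'M[R]_(n, m)) (F : 'M[R]_(r, n)) (s : R[i]) :
    'M[R[i]]_(r, \sum_(k < n) m) :=
  \mxrow_(k < n)
    (complex_mx F *m (complex_mx A - s%:M) ^+ k *m complex_mx B).

(* Main.v *)
Require Import Defs.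
From mathcomp Require Import all_boot all_order all_algebra.
From mathcomp Require Import all_classical all_reals all_analysis.
From mathcomp Require Import complex.
From mathcomp Require Import ring lra.

Set Implicit Arguments.
Unset Strict Implicit.
Unset Printing Implicit Defensive.

Import Order.TTheory GRing.Theory Num.Theory.
Import numFieldNormedType.Exports.

Local Open Scope classical_set_scope.
Local Open Scope ring_scope.

(* If a row vector w annihilates F C, then w F lies in the left kernel of C, an
   A-invariant row space annihilating B by Cayley-Hamilton; along a trajectory
   starting at 0, the coordinates K x for K spanning this kernel solve a
   homogeneous linear equation, hence vanish, and w z = 0 is the only reachable
   value. Conversely, writing A^n = sum_k c_k A^k, the vector polynomial
   p = sum_k A^k B f_k satisfies p' = A p + B u as soon as
   f_(k-1) = f_k' - c_k f_(n-1) and u = f_0' - c_0 f_(n-1), so that f_(n-1) is a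
   free polynomial; Hermite interpolation of f_(n-1) at the end times steers 0
   to any prescribed sum_k A^k B v_k, and adding the free response gives
   controllability. Finally, the spans of the A^k B and of the (A - s)^k B
   (k < n) have the same annihilator by the binomial formula. *)

(** * Linear algebra: Cayley-Hamilton and annihilators of the A^k B *)

Lemma map_mx_exp (K L : pzRingType) (f : {rmorphism K -> L}) n (A : 'M[K]_n) k :
  map_mx f (A ^+ k) = map_mx f A ^+ k.
Proof.
by elim: k => [|k IH]; rewrite ?expr0 ?map_mx1 // !exprS -!mulmxE map_mxM IH.
Qed.

Lemma expmx_lin_comb (K : comNzRingType) n (A : 'M[K]_n) :
  exists c : nat -> K, A ^+ n = \sum_(k < n) c k *: A ^+ k.
Proof.
case: n A => [|n] A; first by exists (fun=> 0); apply/matrixP => -[].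
exists (fun k => - (char_poly A)`_k).
have /eqP := Cayley_Hamilton A.
rewrite -{1}[char_poly A]coefK poly_def raddf_sum size_char_poly.
under eq_bigr do rewrite /= linearZ rmorphXn /= horner_mx_X.
rewrite big_ord_recr /=.
have := monicP (char_poly_monic A); rewrite /lead_coef size_char_poly /= => ->.
rewrite scale1r addrC addr_eq0 => /eqP ->; rewrite -sumrN.
by apply: eq_bigr => k _; rewrite scaleNr.
Qed.

Lemma mul_mxrow_eq0 (K : pzRingType) (n p q : nat) (w : 'M[K]_(p, q)) m
    (M : 'I_n -> 'M[K]_(q, m)) :
  w *m \mxrow_k M k = 0 <-> forall k, w *m M k = 0.
Proof.
rewrite mul_mxrow; split=> [wM0 k|wM0].
  by rewrite -(mxrowK (fun k => w *m M k) k) wM0 submxrow0.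
by rewrite -[RHS]mxrow0; apply: eq_mxrow.
Qed.

Lemma row_free_mulmx_eq0 (K : fieldType) (p q : nat) (M : 'M[K]_(p, q)) :
  row_free M <-> forall w : 'rV_p, w *m M = 0 -> w = 0.
Proof.
split=> [fM w /eqP|inj0]; first by rewrite mulmx_free_eq0 // => /eqP.
rewrite -kermx_eq0; apply/eqP/row_matrixP => i.
by rewrite row0; apply: inj0; rewrite -row_mul mulmx_ker row0.
Qed.

(** Strong induction on k: for k >= n, A^k = A^(k-n) A^n, and Cayley-Hamilton replaces A^n by powers
    below n, so every exponent drops below k. *)
Lemma krylov_annihilator (K : comNzRingType) n m p (A : 'M[K]_n)
    (B : 'M[K]_(n, m)) (v : 'M[K]_(p, n)) :
  (forall k : 'I_n, v *m (A ^+ k *m B) = 0) ->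
  forall k, v *m (A ^+ k *m B) = 0.
Proof.
move=> v0; elim/ltn_ind => k IH.
have [ltkn|lenk] := ltnP k n; first exact: (v0 (Ordinal ltkn)).
have [c cE] := expmx_lin_comb A.
rewrite -(subnK lenk) exprD cE -mulmxE mulmx_sumr mulmx_suml mulmx_sumr.
rewrite big1 // => j _.
rewrite -scalemxAr mulmxE -exprD -scalemxAl -scalemxAr IH ?scaler0 //.
by rewrite -[X in (_ < X)%N](subnK lenk) ltn_add2l.
Qed.

(** Binomial expansion of A = (A - s) + s, whose two summands commute; the previous lemma, applied
    to A - s, kills all the terms. *)
Lemma krylov_annihilator_shift (K : fieldType) n m p (A : 'M[K]_n)
    (B : 'M[K]_(n, m)) (v : 'M[K]_(p, n)) (s : K) :
  (forall k : 'I_n, v *m ((A - s%:M) ^+ k *m B) = 0) ->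
  forall k : 'I_n, v *m (A ^+ k *m B) = 0.
Proof.
move=> /krylov_annihilator v0 k.
have sX i : (s%:M : 'M[K]_n) ^+ i = (s ^+ i)%:M.
  by elim: i => // i IH; rewrite !exprS IH -mulmxE -scalar_mxM.
rewrite -[in A ^+ k](subrK s%:M A) exprDn_comm; last first.
  exact/comm_mx_scalar.
rewrite mulmx_suml mulmx_sumr big1 // => i _.
rewrite sX -mulmxE mul_mx_scalar.
by rewrite -scaler_nat -!scalemxAl -!scalemxAr v0 !scaler0.
Qed.

Lemma row_free_krylov_shift (K : fieldType) n m r (A : 'M[K]_n)
    (B : 'M[K]_(n, m)) (F : 'M[K]_(r, n)) (s : K) :
  row_free (F *m \mxrow_(k < n) (A ^+ k *m B)) ->
  row_free (\mxrow_(k < n) (F *m (A - s%:M) ^+ k *m B)).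
Proof.
move=> /row_free_mulmx_eq0 free; apply/row_free_mulmx_eq0.
move=> w /mul_mxrow_eq0 w0.
apply: free; rewrite mulmxA; apply/mul_mxrow_eq0.
by apply: (krylov_annihilator_shift (s := s)) => k; rewrite -(w0 k) !mulmxA.
Qed.

(** * Matrix-valued derivatives and uniqueness for linear differential equations *)

Lemma is_derive_mxP (R : realType) m n (X : R -> 'M[R]_(m, n)) (t : R) D :
  is_derive t 1 X D <-> forall i j, is_derive t 1 (fun s => X s i j) (D i j).
Proof.
split=> [[dX <-] i j|dX].
  by split; [move/derivable_mxP: dX; exact|rewrite derive_mx // mxE].
have dXt : derivable X t 1 by apply/derivable_mxP => i j; apply: ex_derive.
split=> //; rewrite derive_mx //.
by apply/matrixP => i j; rewrite mxE; apply: derive_val.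
Qed.

Lemma is_derive_mulmx (R : realType) m n p (K : 'M[R]_(m, n))
    (X : R -> 'M[R]_(n, p)) (t : R) D :
  is_derive t 1 X D -> is_derive t 1 (fun s => K *m X s) (K *m D).
Proof.
move=> /is_derive_mxP dX; apply/is_derive_mxP => i j.
rewrite mxE (_ : (fun _ => _) = \sum_k (fun s => K i k *: X s k j)).
  by apply: is_derive_sum => k; apply: is_deriveZ.
by apply/funext => s; rewrite fct_sumE mxE.
Qed.

(** Induction on the exceptional points: an interior one splits the interval in two, and continuity
    of f joins the two inequalities. The base case is the usual monotonicity criterion. *)
Lemma ler_derive_except_finite (R : realType) (s : seq R) (f df : R -> R) a b :
  a <= b -> {within `[a, b]%classic, continuous f} ->
  (forall t, a < t < b -> t \notin s -> is_derive t 1 f (df t) /\ df t <= 0) ->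
  f b <= f a.
Proof.
elim: s a b => [|c s IH] a b leab fc fd.
  have fd' t : t \in `]a, b[%R -> is_derive t 1 f (df t) /\ df t <= 0.
    by rewrite in_itv /= => /fd; apply.
  apply: (ler0_derive1_nincr (a := a) (b := b)) => // t /fd' [ft dt0].
    exact: ex_derive.
  by rewrite derive1E derive_val.
have [|cab] := boolP (a < c < b); last first.
  apply: IH => // t tab ts; apply: fd => //; rewrite inE negb_or ts andbT.
  by apply: contraNneq cab => <-.
move=> /andP[ac cb].
apply: (@le_trans _ _ (f c)); apply: IH; try exact: ltW.
- apply: continuous_subspaceW fc => t /=; rewrite !in_itv /= => /andP[ct ->].
  by rewrite (le_trans (ltW ac)).
- move=> t /andP[ct tb] ts; apply: fd; first by rewrite (lt_trans ac).
  by rewrite inE negb_or ts andbT gt_eqF.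
- apply: continuous_subspaceW fc => t /=; rewrite !in_itv /= => /andP[-> tc].
  by rewrite (le_trans tc) // ltW.
- move=> t /andP[at_ tc] ts; apply: fd; first by rewrite at_ (lt_trans tc).
  by rewrite inE negb_or ts andbT lt_eqF.
Qed.

Lemma cvg_mx (R : realType) (T : Type) (G : set_system T) {FG : Filter G} m n
    (X : T -> 'M[R]_(m, n)) (L : 'M[R]_(m, n)) :
  (forall i j, X t i j @[t --> G] --> L i j) -> X t @[t --> G] --> L.
Proof.
move=> XL; apply/cvgrPdist_le => /= e e0; near=> t.
rewrite /Num.Def.normr /= mx_normrE (bigmax_le _ (ltW e0)) //= => ij _.
rewrite !mxE /=.
move: ij; near: t; apply: filter_forall => -[i j] /=.
exact: ((cvgrPdist_le _ _).1 (XL i j)).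
Unshelve. all: by end_near.
Qed.

Lemma mulmx_continuous (R : realType) m n p (K : 'M[R]_(m, n)) :
  continuous (fun X : 'M[R]_(n, p) => K *m X).
Proof.
move=> X; apply: (cvg_mx (FG := nbhs_filter X)) => i j.
rewrite (_ : (fun _ => _) = \sum_k (fun Y : 'M[R]_(n, p) => K i k * Y k j)).
  rewrite mxE; elim/big_ind2 : _ => [|f a g b fa gb|k _].
  - exact: cvg_cst.
  - exact: (cvgD fa gb).
  - by apply: cvgMl_tmp; exact: coord_continuous.
by apply/funext => Y; rewrite mxE fct_sumE.
Qed.

(* A Gronwall estimate for [|y|^2]. *)
Lemma linear_ode_unique0 (R : realType) n (M : 'M[R]_n) (s : seq R) a b
    (y : R -> 'cV[R]_n) :
  a <= b -> y a = 0 -> {within `[a, b], continuous y} ->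
  (forall t, a < t < b -> t \notin s -> is_derive t 1 y (M *m y t)) ->
  y b = 0.
Proof.
move=> leab ya yc yd.
(* Each term 2 v_i M_ij v_j of the derivative of |v|^2 is at most |M_ij| (v_i^2 + v_j^2), hence at
   most 2 |M_ij| |v|^2; K sums these constants. *)
pose K : R := \sum_i \sum_j `|M i j| *+ 2.
pose phi (v : 'cV[R]_n) := \sum_i v i 0 ^+ 2.
have phi_ge0 v : 0 <= phi v by apply: sumr_ge0 => i _; apply: sqr_ge0.
have le_phi (v : 'cV[R]_n) i : v i 0 ^+ 2 <= phi v.
  by rewrite /phi (bigD1 i) //= lerDl sumr_ge0 // => j _; apply: sqr_ge0.
have phi_eq0 (v : 'cV[R]_n) : phi v <= 0 -> v = 0.
  move=> v0; apply/matrixP => i j; rewrite ord1 mxE; apply/eqP.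
  by rewrite -sqrf_eq0 eq_le sqr_ge0 (le_trans (le_phi v i)).
have phi0 : phi 0 = 0 by rewrite /phi big1 // => i _; rewrite mxE expr0n.
have phi_c : continuous phi.
  rewrite (_ : phi = \sum_i (fun v : 'cV[R]_n => v i 0 ^+ 2)); last first.
    by apply/funext => v; rewrite fct_sumE.
  elim/big_ind : _ => [|f g fc gc|i _] v.
  - exact: cst_continuous.
  - exact: continuousD (fc v) (gc v).
  - apply: (continuous_comp (g := fun x : R => x ^+ 2)).
      exact: coord_continuous.
    exact: exprn_continuous.
pose dphi (v : 'cV[R]_n) := \sum_i 2 * v i 0 * (M *m v) i 0.
have dphi_le v : dphi v <= K * phi v.
  rewrite /dphi /K mulr_suml; apply: ler_sum => i _.
  rewrite mxE mulr_sumr mulr_suml; apply: ler_sum => j _.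
  apply: (@le_trans _ _ (`|M i j| * (v i 0 ^+ 2 + v j 0 ^+ 2))).
    apply: le_trans (ler_norm _) _.
    rewrite mulrCA normrM ler_wpM2l // ler_norml; apply/andP; split.
      by have := sqr_ge0 (v i 0 + v j 0); lra.
    by have := sqr_ge0 (v i 0 - v j 0); lra.
  by rewrite mulrnAl -mulrnAr ler_wpM2l // mulr2n lerD.
have phi_d t : a < t < b -> t \notin s ->
    is_derive t 1 (phi \o y) (dphi (y t)).
  move=> tab ts; have /is_derive_mxP dy := yd t tab ts.
  rewrite (_ : _ \o _ = \sum_i (fun r => y r i 0) ^+ 2); last first.
    by apply/funext => r; rewrite fct_sumE.
  rewrite /dphi; apply: is_derive_sum.
apply: phi_eq0.
(* With the integrating factor, g' = exp(-K t) ([dphi] - K [phi]) <= 0 off [s]; as g(a) = 0, [phi]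
   (y b) <= 0 follows. *)
pose g t := expR (- K * t) * phi (y t).
have : g b <= g a.
  apply: (@ler_derive_except_finite R s g
    (fun t => expR (- K * t) * (dphi (y t) - K * phi (y t)))) => //.
    have ec : continuous (fun t : R => expR (- K * t)).
      move=> t; apply: continuous_comp; last exact: continuous_expR.
      exact: mulrl_continuous.
    move=> t; apply: cvgM; first exact: (continuous_subspaceT ec).
    by apply: continuous_comp; [exact: yc|exact: phi_c].
  move=> t tab ts; split; last first.
    by rewrite pmulr_rle0 ?expR_gt0 // subr_le0.
  have de : is_derive t 1 (fun t : R => expR (- K * t)) (- K * expR (- K * t)).
    by apply: is_derive_eq; rewrite !scaler1 mulrC.
  have := is_deriveM de (phi_d t tab ts).
  move=> /is_derive_eq; apply.
  rewrite /= /GRing.scale /=. ring.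
by rewrite /g ya phi0 mulr0 pmulr_rle0 // expR_gt0.
Qed.

(** * Existence for linear differential equations by power series *)

(** Comparison with |C| times the exponential series at |q| |x|; the absolute values cover C and q
    of any sign. *)
Lemma cvg_pseries_fact (R : realType) (a : nat -> R) C q x :
  (forall k, `|a k| <= C * q ^+ k) ->
  cvgn (pseries (fun k => a k / k`!%:R) x).
Proof.
move=> aC; apply: normed_cvg.
apply: (@series_le_cvg _ _ (fun k => `|C| * exp_coeff (`|q| * `|x|) k)).
- by move=> k /=; apply: normr_ge0.
- move=> k; apply: mulr_ge0 => //.
  by rewrite /exp_coeff /= divr_ge0 // exprn_ge0 // mulr_ge0.
- move=> k; rewrite /exp_coeff /= !normrM normfV normrX exprMn.
  rewrite (ger0_norm (ler0n _ _)) mulrAC mulrA mulrA.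
  rewrite ler_wpM2r ?invr_ge0 // ler_wpM2r ?exprn_ge0 //.
  by rewrite (le_trans (aC k)) // (le_trans (ler_norm _)) // normrM normrX.
have := @is_cvg_seriesZ R (exp_coeff (`|q| * `|x|)) `|C|; apply.
exact: is_cvg_series_exp_coeff.
Qed.

Lemma normr_mulmx_exp_le (R : realDomainType) n (A : 'M[R]_n) (x : 'cV[R]_n) :
  exists C q, forall i k, `|(A ^+ k *m x) i 0| <= C * q ^+ k.
Proof.
pose c := \sum_i `|x i 0|; pose q := \sum_i \sum_j `|A i j|.
have q_ge0 : 0 <= q by apply: sumr_ge0 => i _; apply: sumr_ge0.
exists c, q => i k; elim: k i => [|k IH] i.
  by rewrite expr0 mulr1 mul1mx /c (bigD1 i) //= lerDl sumr_ge0.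
rewrite exprS -mulmxE -mulmxA mxE (le_trans (ler_norm_sum _ _ _)) //.
apply: (@le_trans _ _ (\sum_j `|A i j| * (c * q ^+ k))).
  by apply: ler_sum => j _; rewrite normrM ler_wpM2l.
rewrite -mulr_suml exprS [leRHS]mulrCA; apply: ler_wpM2r.
  by rewrite mulr_ge0 ?exprn_ge0 // sumr_ge0.
by rewrite /q [leRHS](bigD1 i) //= lerDl sumr_ge0 // => ? _; rewrite sumr_ge0.
Qed.

(** The solution is exp((t - t0) A) x0, built coordinate by coordinate as a power series in t -
    t0. *)
Lemma linear_ode_exists (R : realType) n (A : 'M[R]_n) (x0 : 'cV[R]_n)
    (t0 : R) :
  exists x : R -> 'cV[R]_n,
    x t0 = x0 /\ forall t : R, is_derive t 1 x (A *m x t).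
Proof.
have [C [q bound]] := normr_mulmx_exp_le A x0.
(* Coefficients of the l-th derivative of the i-th coordinate of exp(t A) x0; keeping l free turns
   termwise differentiation into l -> l + 1. *)
pose c l i k := (A ^+ (k + l) *m x0) i 0 / k`!%:R.
have cc l i x : cvgn (pseries (c l i) x).
  apply: (@cvg_pseries_fact _ _ (C * q ^+ l) q) => k.
  by rewrite -mulrA -exprD addnC bound.
have dc l i : pseries_diffs (c l i) = c l.+1 i.
  apply/funext => k; rewrite /pseries_diffs /c factS natrM addSnnS.
  by rewrite invfM mulrCA mulVKf.
pose e l i x := limn (pseries (c l i) x).
have de l i (x : R) : is_derive x 1 (e l i) (e l.+1 i x).
  (* Termwise differentiation at x asks for convergence at a point of larger modulus, here |x| +
     1. *)
  rewrite /e -dc; apply: (@pseries_snd_diffs _ _ (`|x| + 1)); rewrite ?dc //.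
  by rewrite [ltRHS]ger0_norm ?addr_ge0 // ltrDl.
have eA i x : e 1 i x = \sum_j A i j * e 0 j x.
  apply/cvg_lim => //.
  rewrite (_ : pseries _ _ = \sum_j (fun k => A i j * pseries (c 0 j) x k)).
    elim/big_ind2 : _ => [|f a g b fa gb|j _].
    - exact: cvg_cst.
    - exact: cvgD.
    - by apply: cvgMl_tmp; exact: cc.
  apply/funext => k; rewrite fct_sumE /pseries /series /=.
  under [RHS]eq_bigr do rewrite mulr_sumr.
  rewrite exchange_big /=; apply: eq_bigr => l _.
  rewrite /c addn1 exprS -mulmxE -mulmxA mxE !mulr_suml.
  by apply: eq_bigr => j _; rewrite addn0 !mulrA.
exists (fun t => \col_i e 0 i (t - t0)); split.
  apply/matrixP => i j; rewrite ord1 mxE subrr.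
  rewrite /e /pseries; apply: lim_near_cst => //.
  (* Nonempty partial sums at 0 reduce to their constant term. *)
  near=> k; rewrite -[k]prednK; last by near: k; exists 1%N.
  rewrite /series /= big_nat_recl // big1 ?addr0.
    by rewrite expr0 mulr1 /c fact0 divr1 mul1mx.
  by move=> l _; rewrite expr0n mulr0.
move=> t; apply/is_derive_mxP => i j.
have -> : (fun s => (\col_i e 0 i (s - t0)) i j) = e 0 i \o (fun s => s - t0).
  by apply/funext => s; rewrite mxE.
rewrite mxE; under eq_bigr do rewrite mxE; rewrite -eA -[e 1 i _]mulr1.
have ds : is_derive t 1 (fun s : R => s - t0) 1 by exact: is_derive_shift.
exact: (is_derive1_comp (f := e 0 i) (g := fun s => s - t0) (x := t)
  (de 0 i (t - t0)) ds).
Unshelve. all: by end_near.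
Qed.

(** * Hermite interpolation for the free polynomial *)

Section flat_output.
Context {K : numFieldType} (c : nat -> K).

(* For A^n = sum_k c0_k A^k and c j = c0_(n-1-j), this is f_(n-1-j) of the
   header as a function of g = f_(n-1), and the input u for j = n. *)
Fixpoint flat_deriv (g : {poly K}) j : {poly K} :=
  if j is i.+1 then (flat_deriv g i)^`() - c i *: g else g.

Lemma flat_derivD g1 g2 j :
  flat_deriv (g1 + g2) j = flat_deriv g1 j + flat_deriv g2 j.
Proof. by elim: j => //= j ->; rewrite derivD scalerDr opprD addrACA. Qed.

Lemma flat_derivZ a g j : flat_deriv (a *: g) j = a *: flat_deriv g j.
Proof.
by elim: j => //= j ->; rewrite derivZ scalerBr !scalerA [c j * a]mulrC.
Qed.

(** Each step lowers the guaranteed order of vanishing at a by one. The derivative contributes the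
    factors of the falling factorial, while the subtracted multiple of g still vanishes to order l
    and leaves p(a) unchanged. *)
Lemma flat_deriv_XsubC_exp a l q j : (j <= l)%N ->
  exists2 p, flat_deriv (('X - a%:P) ^+ l * q) j = ('X - a%:P) ^+ (l - j) * p
    & p.[a] = (l ^_ j)%:R * q.[a].
Proof.
elim: j => [_|j IH ltjl]; first by exists q; rewrite ?subn0 // ffactn0 mul1r.
have [p pE pa] := IH (ltnW ltjl); rewrite /= pE -subnSK //.
exists ((l - j)%:R * p + ('X - a%:P) * p^`()
        - c j *: (('X - a%:P) ^+ j.+1 * q)).
  rewrite derivM deriv_exp derivXsubC mul1r.
  rewrite -(subnSK ltjl) -[in ('X - a%:P) ^+ l](subnK ltjl) exprD exprS /=.
  by rewrite -!mul_polyC -mulr_natl; ring.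
rewrite ffactnSr natrM -polyC_natr.
rewrite !(hornerE, horner_exp) /= pa subrr expr0n /=.
rewrite !(mul0r, mulr0, subr0, addr0).
by rewrite mulrCA mulrA.
Qed.

(** Triangular interpolation: adding a multiple of (X - b)^l to q leaves the values of index j < l
    at b unchanged and shifts the l-th by that multiple of l! (b - a)^N, which is nonzero in
    characteristic 0. *)
Lemma hermite_flat_deriv (a b : K) N l (v : nat -> K) :
  a != b ->
  exists q : {poly K}, forall j, (j < l)%N ->
    (flat_deriv (('X - a%:P) ^+ N * q) j).[b] = v j.
Proof.
move=> ab; elim: l => [|l [q qv]]; first by exists 0.
have [p] := @flat_deriv_XsubC_exp b l (('X - a%:P) ^+ N) l (leqnn _).
rewrite subnn expr0 mul1r => pE pb.
pose u := (v l - (flat_deriv (('X - a%:P) ^+ N * q) l).[b]) / p.[b].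
exists (q + u *: ('X - b%:P) ^+ l) => j; rewrite ltnS leq_eqVlt => lejl.
rewrite mulrDr -scalerAr [_ * (_ ^+ l)]mulrC flat_derivD flat_derivZ.
rewrite hornerD hornerZ.
case/predU1P: lejl => [->|ltjl].
  rewrite pE /u divfK; first by rewrite addrC subrK.
  rewrite pb mulf_neq0 //.
    by rewrite pnatr_eq0 -lt0n ffact_gt0.
  by rewrite horner_exp !hornerE expf_neq0 // subr_eq0 eq_sym.
rewrite qv //.
have [p' -> _] := flat_deriv_XsubC_exp b (('X - a%:P) ^+ N) (ltnW ltjl).
rewrite hornerM horner_exp !hornerE subrr expr0n subn_eq0 leqNgt ltjl /=.
by rewrite !(mul0r, mulr0, addr0).
Qed.

End flat_output.

(** * Steering from the origin by polynomial inputs *)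

Lemma is_derive_continuous (R : realType) m n (X : R -> 'M[R]_(m, n))
    (t : R) D :
  is_derive t 1 X D -> {for t, continuous X}.
Proof. by move=> [dX _]; apply/differentiable_continuous/derivable1_diffP. Qed.

Lemma steer_krylov (R : realType) n m (A : 'M[R]_n) (B : 'M[R]_(n, m)) (a b : R)
    (v : 'I_n -> 'cV[R]_m) : a != b ->
  exists (u : R -> 'cV[R]_m) (p : R -> 'cV[R]_n),
    [/\ continuous u, p a = 0, p b = \sum_(k < n) A ^+ k *m B *m v k
      & forall t : R, is_derive t 1 p (A *m p t + B *m u t)].
Proof.
move=> ab; have [c0 cE] := expmx_lin_comb A.
pose c j := c0 (n - j.+1)%N.
(* One polynomial per input coordinate. The index is reversed because the j-th iterate multiplies
   A^(n-1-j) B; the default 0 is never reached, as j < n. *)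
have /boolp.choice[q qv] (i : 'I_m) :
    exists q : {poly R}, forall j, (j < n)%N ->
    (flat_deriv c (('X - a%:P) ^+ n * q) j).[b] =
      oapp (fun k => v (rev_ord k) i 0) 0 (insub j).
  exact: (hermite_flat_deriv c n n _ ab).
(* The factor (X - a)^n makes the iterates of index j < n vanish at a, so that p(a) = 0. *)
pose g i := ('X - a%:P) ^+ n * q i.
pose H j (t : R) : 'cV[R]_m := \col_i (flat_deriv c (g i) j).[t].
have dH j (t : R) : is_derive t 1 (H j) (H j.+1 t + c j *: H 0%N t).
  apply/is_derive_mxP => i k.
  rewrite (_ : (fun s => H j s i k) = horner (flat_deriv c (g i) j)).
    by apply: is_derive_eq; rewrite !mxE /= !hornerE subrK.
  by apply/funext => s; rewrite mxE.
exists (H n), (fun t => \sum_(j < n) A ^+ (n - j.+1) *m B *m H j t); split.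
- by move=> t; apply: is_derive_continuous (dH n t).
- rewrite big1 // => j _.
  suff -> : H j a = 0 by rewrite mulmx0.
  apply/matrixP => i k; rewrite !mxE.
  have [p -> _] := flat_deriv_XsubC_exp c a (q i) (ltnW (ltn_ord j)).
  rewrite hornerM horner_exp hornerXsubC subrr expr0n subn_eq0 leqNgt.
  by rewrite ltn_ord mul0r.
- rewrite [RHS](reindex_inj rev_ord_inj) /=; apply: eq_bigr => j _.
  congr (_ *m _).
  by apply/matrixP => i k; rewrite ord1 mxE qv //= valK.
move=> t.
rewrite (_ : (fun _ => _) =
    \sum_(j < n) (fun t => A ^+ (n - j.+1) *m B *m H j t)).
  apply: is_derive_eq.
    by apply: is_derive_sum => j; apply: is_derive_mulmx; exact: dH.
  under eq_bigr do rewrite mulmxDr.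
  rewrite big_split /=.
  (* The correction terms reassemble A^n, the top power in A p that p itself does not carry. *)
  have -> : \sum_(j < n) A ^+ (n - j.+1) *m B *m (c j *: H 0%N t) =
      A ^+ n *m B *m H 0%N t.
    rewrite cE !mulmx_suml (reindex_inj rev_ord_inj) /=.
    apply: eq_bigr => j _; rewrite -scalemxAr -!scalemxAl /c.
    by rewrite subnSK // subKn // ltnW.
  rewrite mulmx_sumr.
  (* Both sides equal this sum: splitting off j = 0 isolates A^n B H_0, splitting off j = n isolates
     the input term B H_n. *)
  transitivity (\sum_(j < n.+1) A ^+ (n - j) *m B *m H j t).
    by rewrite big_ord_recl subn0 addrC.
  rewrite big_ord_recr /= subnn mul1mx; congr (_ + _); apply: eq_bigr => j _.
  by rewrite -(subnSK (ltn_ord j)) exprS -mulmxE !mulmxA.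
by apply/funext => s; rewrite fct_sumE.
Qed.

(** * The rank conditions and controllability *)

Lemma target_controllable_free (R : realType) n m r (t0 : R) (A : 'M[R]_n)
    (B : 'M[R]_(n, m)) (F : 'M[R]_(r, n)) :
  target_output_controllable t0 A B F -> row_free (F *m controllability_mx A B).
Proof.
move=> ctr; apply/row_free_mulmx_eq0 => w wFC0.
set C := controllability_mx A B in wFC0.
have kerCP p (v : 'M[R]_(p, n)) :
    (v <= kermx C)%MS <-> forall k : 'I_n, v *m (A ^+ k *m B) = 0.
  have vC0 := mul_mxrow_eq0 v (fun k : 'I_n => A ^+ k *m B).
  by split=> [/sub_kermxP/vC0|/vC0 v0] //; apply/sub_kermxP.
have KC0 k : kermx C *m (A ^+ k *m B) = 0.
  by move: k; apply: krylov_annihilator; apply/kerCP.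
(* All A^k B are annihilated, including k = n, so the kernel is A-invariant: K A = M K for K =
   [kermx C]. With K B = 0, this gives (K x)' = M (K x). *)
have /submxP[M KA] : (kermx C *m A <= kermx C)%MS.
  by apply/kerCP => k; rewrite -(KC0 k.+1) exprS -mulmxE !mulmxA.
have KB : kermx C *m B = 0 by rewrite -(KC0 0%N) mul1mx.
have /submxP[D wFE] : (w *m F <= kermx C)%MS.
  by apply/sub_kermxP; rewrite -mulmxA.
apply/matrixP => i0 i; rewrite ord1 [RHS]mxE {i0}.
(* Steering 0 to the i-th basis vector makes w z the i-th entry of w. *)
have [t1 [u [x [lt01 [s [uc _ _]] [x0 xc xd] Fx]]]] := ctr 0 (delta_mx i 0).
have Kx : kermx C *m x t1 = 0.
  apply: (@linear_ode_unique0 _ _ M s t0 t1 (fun t => kermx C *m x t)) => //.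
  - exact: ltW.
  - by rewrite x0 mulmx0.
  - move=> t.
    exact: (continuous_comp (xc t) (@mulmx_continuous _ _ _ 1 (kermx C) (x t))).
  - move=> t t01 ts; have := is_derive_mulmx (kermx C) (xd t t01 (uc t t01 ts)).
    rewrite mulmxDr (mulmxA _ A) (mulmxA _ B) KA KB mul0mx addr0.
    by rewrite -(mulmxA M (kermx C)).
have : w *m (F *m x t1) = 0 by rewrite mulmxA wFE -mulmxA Kx mulmx0.
by move=> /matrixP /(_ 0 0); rewrite Fx -colE !mxE => ->.
Qed.

Lemma row_free_target_controllable (R : realType) n m r (t0 : R) (A : 'M[R]_n)
    (B : 'M[R]_(n, m)) (F : 'M[R]_(r, n)) :
  row_free (F *m controllability_mx A B) -> target_output_controllable t0 A B F.
Proof.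
move=> /row_freeP[D FCD] x0 z.
have [y [y0 yd]] := linear_ode_exists A x0 t0.
have lt01 : t0 < t0 + 1 by rewrite ltrDl.
(* With D a right inverse of F C, F C w is exactly what the free response y misses of the target; p
   is then steered to C w. *)
pose w := D *m (z - F *m y (t0 + 1)).
have [u [p [uc p0 p1 pd]]] :=
  steer_krylov A B (fun k => submxcol w k) (negbT (lt_eqF lt01)).
have xd (t : R) : is_derive t 1 (y + p) (A *m (y t + p t) + B *m u t).
  by rewrite mulmxDr -addrA; exact: is_deriveD (yd t) (pd t).
exists (t0 + 1), u, (y + p); split=> //.
- exists [::]; split=> [t _ _|t _|t _]; first exact: uc.
    by apply: (cvgP (u t)); apply: cvg_at_right_filter; exact: uc.
  by apply: (cvgP (u t)); apply: cvg_at_left_filter; exact: uc.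
- split=> [||t _ _] //; first by rewrite fctE y0 p0 addr0.
  apply: continuous_subspaceT => t; exact: is_derive_continuous (xd t).
have Cw : controllability_mx A B *m w = p (t0 + 1).
  by rewrite p1 -{1}(submxcolK w) mul_mxrow_mxcol.
by rewrite fctE mulmxDr -Cw mulmxA /w mulmxA FCD mul1mx addrC subrK.
Qed.

Theorem theorem1 (R : realType) (n m r : nat) (t0 : R)
    (A : 'M[R]_n) (B : 'M[R]_(n, m)) (F : 'M[R]_(r, n))
    (F_full_row_rank : \rank F = r) :
  [<-> target_output_controllable t0 A B F;
       \rank F = \rank (F *m controllability_mx A B);
       forall s : R[i], \rank F = \rank (shifted_target_mx A B F s)].
Proof.
have FCE : complex_mx (F *m controllability_mx A B) =
    complex_mx F *m \mxrow_(k < n) (complex_mx A ^+ k *m complex_mx B).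
  rewrite /complex_mx map_mxM; congr (_ *m _).
  apply/matrixP => i j; rewrite mxE [in LHS]mxE [RHS]mxE.
  by rewrite -map_mx_exp -map_mxM [RHS]mxE.
tfae; rewrite F_full_row_rank.
- by move=> /target_controllable_free /eqP.
(* Rank is unchanged by extension to the complex numbers, where the shift by s takes place. *)
- move=> rkFC s; apply/esym/eqP; apply: row_free_krylov_shift.
  by rewrite -FCE /row_free mxrank_map -rkFC.
(* At s = 0 the shifted matrix is the complexification of F C. *)
- move=> /(_ 0) rk0; apply/row_free_target_controllable.
  rewrite /row_free -(mxrank_map (real_complex R)) [X in _ == X]rk0.
  rewrite -/(complex_mx _) FCE.
  rewrite mul_mxrow; apply/eqP; congr (\rank _); apply: eq_mxrow => k.
  by rewrite raddf0 subr0 mulmxA.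
Qed.
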